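(* Let $\mu\in\mathcal P(\Omega)$ satisfy the exact Minty variational inequality $$\langle J(\eta,\cdot),\eta-\mu\rangle\ge0\qquad\forall\,\eta\in\mathcal P(\Omega).$$ Assume that, for every $\eta\in\mathcal P(\Omega)$, $$\lim_{t\downarrow0}\bigl\langle J\bigl((1-t)\mu+t\eta,\cdot\bigr),\eta-\mu\bigr\rangle=\langle J(\mu,\cdot),\eta-\mu\rangle.$$ Then $\mu$ satisfies the exact variational inequality $$\langle J(\mu,\cdot),\eta-\mu\rangle\ge0\qquad\forall\,\eta\in\mathcal P(\Omega).$$
   Context: $\Omega\subset\mathbb R^d$ is a nonempty compact set, $\mathcal P(\Omega)$ is the set of Borel probability measures on $\Omega$, and $J:\mathcal P(\Omega)\times\Omega\to\mathbb R$ is such that $J(\mu,\cdot)\in C(\Omega)$ for every $\mu\in\mathcal P(\Omega)$. For $f\in C(\Omega)$ and a finite signed measure $\xi$, $\langle f,\xi\rangle:=\int_\Omega f\,d\xi$. *)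

(* Defs.v *)
From HB Require Import structures.
From mathcomp Require Import all_boot all_order all_algebra.
From mathcomp Require Import all_classical all_reals all_analysis.

Set Implicit Arguments.
Unset Strict Implicit.
Unset Printing Implicit Defensive.

Import Order.TTheory GRing.Theory Num.Theory.
Import numFieldNormedType.Exports.

Local Open Scope classical_set_scope.
Local Open Scope ring_scope.

(* The set A, as a type with the subspace topology and the Borel sigma-algebra
   of that topology. A measurableType is pointed, hence the argument A0. *)
Definition borel_space (T : topologicalType) (A : set T) (A0 : A !=set0)
  : Type := set_type A.

Section borel_space.
Context (T : topologicalType) (A : set T) (A0 : A !=set0).

Let borel_space_point : borel_space A0 :=
  let: exist x Ax := cid A0 in SigSub (mem_set Ax).

HB.instance Definition _ := Topological.copy (borel_space A0) (set_type A).
HB.instance Definition _ := isPointed.Build (borel_space A0) borel_space_point.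
HB.instance Definition _ := Measurable.copy (borel_space A0)
  (g_sigma_algebraType (@open (borel_space A0))).

End borel_space.

Section charge_integral.
Context d (T : measurableType d) (R : realType).

(* Integral against a finite signed measure, through its Jordan decomposition;
   any two Hahn decompositions give the same Jordan decomposition. *)
Definition pairing (f : T -> R) (xi : {charge set T -> \bar R}) : R :=
  let: exist P hP := cid (Hahn_decomposition xi) in
  let: exist N PN := cid hP in
  \int[jordan_pos PN]_x f x - \int[jordan_neg PN]_x f x.

Definition charge_sub (eta mu : probability T R) : {charge set T -> \bar R} :=
  cadd (charge_of_finite_measure eta) (copp (charge_of_finite_measure mu)).

End charge_integral.

Section mixture.
Context d (T : measurableType d) (R : realType).

Section def.
Variables (t : {i01 R}) (mu eta : probability T R).

Definition mixture : set T -> \bar R :=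
  measure_add (mscale (1 - t%:num)%:nng mu) (mscale t%:num%:nng eta).

HB.instance Definition _ := Measure.on mixture.

Lemma mixtureE A :
  mixture A = ((1 - t%:num)%:E * mu A + t%:num%:E * eta A)%E.
Proof. exact: measure_addE. Qed.

Let mixture_setT : mixture setT = 1%E.
Proof. by rewrite mixtureE !probability_setT !mule1 -EFinD subrK. Qed.

HB.instance Definition _ :=
  Measure_isProbability.Build _ _ _ mixture mixture_setT.

End def.

Definition pmixture t mu eta : probability T R := mixture t mu eta.

End mixture.

(* The mixture makes sense for weights in [0, 1] only; a limit as t decreases
   to 0 over the reals does not see the truncation. *)
Section clamp.
Context (R : realType) (t : R).

Let clamp_ge0 : 0 <= Num.max 0 (Num.min t 1).
Proof. by rewrite le_max lexx. Qed.

Let clamp_le1 : Num.max 0 (Num.min t 1) <= 1.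
Proof. by rewrite ge_max ler01 ge_min lexx orbT. Qed.

Definition clamp01 : {i01 R} := Itv01 clamp_ge0 clamp_le1.

Lemma clamp01E : 0 <= t <= 1 -> clamp01%:num = t.
Proof. by move=> /andP[t0 t1]; rewrite /= min_l// max_r. Qed.

End clamp.

(* Main.v *)
Require Import Defs.
From mathcomp Require Import all_boot all_order all_algebra.
From mathcomp Require Import all_classical all_reals all_analysis.
From mathcomp Require Import measurable_realfun.
Import Order.TTheory GRing.Theory Num.Theory.
Import numFieldNormedType.Exports.
Local Open Scope classical_set_scope.
Local Open Scope ring_scope.

(** This is Minty's trick.  For t in ]0, 1], put eta_t = (1 - t) mu + t eta.
    Then eta_t - mu = t (eta - mu), so the Minty inequality at eta_t reads
    0 <= t <J(eta_t), eta - mu>.  Dividing by t and letting t decrease to 0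
    gives the conclusion, the limit being the one that is assumed.

    The step that needs an argument is the extraction of the factor t
    ([pairing_scale]): the pairing integrates against the two parts of a Jordan
    decomposition that comes from an arbitrarily chosen Hahn decomposition, and
    the choices made for eta_t - mu and for eta - mu are unrelated.  A Hahn
    decomposition of t xi with 0 < t is one of xi as well, and any two Hahn
    decompositions of xi give the same Jordan parts. *)

Lemma Rintegral_mscale {d} {T : measurableType d} {R : realType}
    (m : {measure set T -> \bar R}) (k : {nonneg R}) (f : T -> R) :
  0 < k%:num -> measurable_fun setT f ->
  \int[mscale k m]_x f x = k%:num * \int[m]_x f x.
Proof.
move=> k0 mf; have mEf : measurable_fun [set: T] (EFin \o f).
  exact/measurable_EFinP.
rewrite /Rintegral integralE [in RHS]integralE.
rewrite !ge0_integral_mscale//; last 2 first.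
- exact: measurable_funeneg.
- exact: measurable_funepos.
(* Without integrability, a and b may both be +oo; the factor still comes out
   of +oo - +oo, because k is positive and finite. *)
have -> : forall a b : \bar R,
    (k%:num%:E * a - k%:num%:E * b = k%:num%:E * (a - b))%E.
  have ky : (k%:num%:E * +oo = +oo :> \bar R)%E by rewrite gt0_muley ?lte_fin.
  have kNy : (k%:num%:E * -oo = -oo :> \bar R)%E by rewrite gt0_muleNy ?lte_fin.
  move=> [a| |] [b| |]; rewrite /= ?ky ?kNy//.
  by rewrite -EFinM -!EFinD -EFinM mulrBr.
(* An infinite integral has real value 0, on both sides. *)
case: (_ - _)%E => [r| |] //=.
- by rewrite gt0_muley ?lte_fin//= mulr0.
- by rewrite gt0_muleNy ?lte_fin//= mulr0.
Qed.

Lemma hahn_decomposition_scale {d} {T : measurableType d} {R : realType}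
    (xi xi' : {charge set T -> \bar R}) (k : R) (P N : set T) :
  0 < k -> (forall A, measurable A -> xi' A = (k%:E * xi A)%E) ->
  hahn_decomposition xi' P N -> hahn_decomposition xi P N.
Proof.
move=> k0 xi'E [[mP posP] [mN negN] PN PN0]; split => //; split => // A mA.
- by move=> /(posP _ mA); rewrite xi'E// pmule_rge0 ?lte_fin.
- by move=> /(negN _ mA); rewrite xi'E// pmule_rle0 ?lte_fin.
Qed.

(** Both Jordan parts of xi' are k times those of xi, whatever Hahn
    decompositions they come from, because that of xi' is also one of xi. *)
Lemma pairing_scale {d} {T : measurableType d} {R : realType}
    (xi xi' : {charge set T -> \bar R}) (k : R) (f : T -> R) :
  0 < k -> (forall A, measurable A -> xi' A = (k%:E * xi A)%E) ->
  measurable_fun setT f ->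
  pairing f xi' = k * pairing f xi.
Proof.
move=> k0 xi'E mf; rewrite /pairing.
case: cid => P' hP'; case: cid => N' PN'.
case: cid => P hP; case: cid => N PN.
have PN'xi := hahn_decomposition_scale xi xi' k P' N' k0 xi'E PN'.
have uniqPN := @Hahn_decomposition_uniq _ _ _ xi _ _ _ _ PN'xi PN.
have [[mP' _] [mN' _] _ _] := PN'.
pose k' := NngNum (ltW k0).
have posE : \int[jordan_pos PN']_x f x = k * \int[jordan_pos PN]_x f x.
  rewrite -(Rintegral_mscale _ k')//; congr fine.
  apply: eq_measure_integral => A mA _.
  rewrite /= /mscale /= !jordan_posE !cjordan_posE /crestr0 /crestr mem_set//.
  by rewrite xi'E; [have [-> _] := uniqPN _ mA|exact: measurableI].
have negE : \int[jordan_neg PN']_x f x = k * \int[jordan_neg PN]_x f x.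
  rewrite -(Rintegral_mscale _ k')//; congr fine.
  apply: eq_measure_integral => A mA _.
  rewrite /= /mscale /= !jordan_negE !cjordan_negE /crestr0 /crestr mem_set//.
  rewrite xi'E; last exact: measurableI.
  by have [_ ->] := uniqPN _ mA; rewrite muleN.
by rewrite posE negE mulrBr.
Qed.

Lemma charge_subE {d} {T : measurableType d} {R : realType}
    (eta mu : probability T R) (A : set T) :
  charge_sub eta mu A = (eta A - mu A)%E.
Proof. by []. Qed.

Lemma charge_sub_pmixture {d} {T : measurableType d} {R : realType}
    (t : {i01 R}) (mu eta : probability T R) (A : set T) : measurable A ->
  charge_sub (pmixture t mu eta) mu A = (t%:num%:E * charge_sub eta mu A)%E.
Proof.
move=> mA; rewrite !charge_subE /= mixtureE.
have /fineK <- : mu A \is a fin_num by exact: fin_num_measure.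
have /fineK <- : eta A \is a fin_num by exact: fin_num_measure.
rewrite -!EFinM -EFinD; congr EFin.
by rewrite mulrBl mul1r mulrBr addrAC [X in X + _]addrAC subrr sub0r addrC.
Qed.

Lemma continuous_borel_measurable {R : realType} {T : topologicalType}
    {A : set T} (A0 : A !=set0) (f : borel_space A0 -> R) :
  continuous f -> measurable_fun setT f.
Proof.
move=> /continuousP cf; apply: (measurability _ (RGenOpens.measurableE R)).
move=> _ [_ [a [b ->] <-]]; rewrite setTI.
by apply: sub_sigma_algebra; exact/cf/interval_open.
Qed.

Theorem proposition3p3 (R : realType) (d : nat) (Omega : set 'rV[R]_d)
  (Omega0 : Omega !=set0) (cptOmega : compact Omega)
  (J : probability (borel_space Omega0) R -> borel_space Omega0 -> R)
  (contJ : forall mu, continuous (J mu))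
  (mu : probability (borel_space Omega0) R)
  (minty : forall eta : probability (borel_space Omega0) R,
    0 <= pairing (J eta) (charge_sub eta mu))
  (limJ : forall eta : probability (borel_space Omega0) R,
    pairing (J (pmixture (clamp01 t) mu eta)) (charge_sub eta mu) @[t --> 0^'+]
      --> pairing (J mu) (charge_sub eta mu)) :
  forall eta : probability (borel_space Omega0) R,
    0 <= pairing (J mu) (charge_sub eta mu).
Proof.
move=> eta; apply: (cvgr_to_ge (limJ eta)).
near=> t.
have t0 : 0 < t by near: t; exact: nbhs_right_gt.
have t1 : t <= 1 by near: t; exact: nbhs_right_ltW.
have tE : (clamp01 t)%:num = t by rewrite clamp01E// ltW.
rewrite -(pmulr_rge0 _ t0) -(pairing_scale _
  (charge_sub (pmixture (clamp01 t) mu eta) mu))//.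
- by move=> A mA; rewrite charge_sub_pmixture// tE.
- exact: continuous_borel_measurable.
Unshelve. all: by end_near. Qed.
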